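(* Let $f$ be a minor-monotone graph parameter which is $(c,r)$-bounded from below by a function $\widetilde{f}$ for some $c>1$ and $r\ge 0$. Let $C\ge 10c$ and let $p=p(n)$ satisfy $0<p\le 2/n$ and $n^2p=\omega(1)$. Let $H$ be an $n$-vertex connected graph with maximum degree $\Delta$ such that $1\le \Delta\le n^2p/(9600C)$. Let $G=G(n,p)$ be on the vertex set $V(H)$ and $R:=H\cup G$. Put $L=19200\,C\Delta$ and $M=(96C\Delta)^2 n^{-2}p^{-1}$. Then with high probability \[ f(R)\ \ge\ \begin{cases} r\cdot \widetilde f\!\left(n^2pL^{-1},\ 1-e^{-M}\right) & \text{if } \Delta\le \sqrt{n^2p\log(n^2p)},\\[2pt] f\!\left(K_{n^2pL^{-1}}\right) & \text{otherwise},\end{cases} \] where $K_t$ denotes the complete graph on $t$ vertices.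
   Context: All graphs are finite, simple and undirected. $G(n,p)$ is the binomial random graph on $n$ vertices in which each pair is an edge independently with probability $p$. Asymptotics are as $n\to\infty$; $x=o(1)$ means $x\to 0$, $y=\omega(1)$ means $y\to\infty$; an event holds with high probability (whp) if it holds with probability $1-o(1)$. $\log$ is the natural logarithm. A graph parameter $f$ is minor-monotone if $f(H)\le f(G)$ whenever $H$ is a minor of $G$. Given $c,r>0$ (or $r\ge0$) and a function $\widetilde f:\mathbb N\times[0,1]\to\mathbb R_{\ge 0}$, $f$ is $(c,r)$-bounded from below by $\widetilde f$ if for every $p=p(n)\in[c/n,1]$, with probability $1-o(1)$ we have $f(G(n,p))\ge r\cdot\widetilde f(n,p)$. For the union $H\cup G$, both graphs are on the same vertex set. *)

(* Defs.v *)
From HB Require Import structures.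
From mathcomp Require Import all_boot all_order all_algebra.
From mathcomp Require Import all_classical all_reals all_analysis.
Set Implicit Arguments. Unset Strict Implicit. Unset Printing Implicit Defensive.
Import Order.TTheory GRing.Theory Num.Theory.
Import numFieldNormedType.Exports.
Local Open Scope classical_set_scope.
Local Open Scope ring_scope.

(* A (simple) graph on the vertex set 'I_n is given by its edge set,
   a set of 2-element subsets of 'I_n. *)
Definition sgraph (n : nat) := {set {set 'I_n}}.

Definition is_graph n (E : sgraph n) : bool := [forall e in E, #|e| == 2%N].

Definition adj n (E : sgraph n) (x y : 'I_n) : bool := (x != y) && ([set x; y]%SET \in E).

Definition gunion n (H G : sgraph n) : sgraph n := H :|: G.

Definition complete_graph (t : nat) : sgraph t := [set e : {set 'I_t} | #|e| == 2%N]%SET.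

Definition connected_graph n (E : sgraph n) : Prop :=
  forall x y : 'I_n, connect (adj E) x y.

Definition connected_in n (E : sgraph n) (S : {set 'I_n}) : Prop :=
  forall x y, x \in S -> y \in S ->
    connect [rel u v | [&& u \in S, v \in S & adj E u v]] x y.

Definition maxdeg n (E : sgraph n) : nat := \max_(v : 'I_n) #|[set u | adj E v u]%SET|.

Definition minor m n (H : sgraph m) (G : sgraph n) : Prop :=
  exists phi : 'I_m -> {set 'I_n},
    [/\ forall i, phi i != @finset.set0 _,
        forall i j, i != j -> phi i :&: phi j == @finset.set0 _,
        forall i, connected_in G (phi i) &
        forall i j, adj H i j -> exists u v, [/\ u \in phi i, v \in phi j & adj G u v]].

Definition minor_monotone (R : realType) (f : forall n, sgraph n -> R) : Prop :=
  forall m n (H : sgraph m) (G : sgraph n), is_graph H -> is_graph G ->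
    minor H G -> f m H <= f n G.

Definition PrGnp (R : realType) (n : nat) (p : R) (A : sgraph n -> Prop) : R :=
  \sum_(E : sgraph n | is_graph E && `[< A E >])
     p ^+ #|E| * (1 - p) ^+ ('C(n, 2) - #|E|).

Definition whp (R : realType) (P : forall n, sgraph n -> Prop) (p : nat -> R) : Prop :=
  ((fun n => PrGnp (p n) (P n)) @ \oo --> (1 : R)).

Definition bounded_below (R : realType) (f : forall n, sgraph n -> R)
    (tf : nat -> R -> R) (c r : R) : Prop :=
  forall p : nat -> R,
    (\forall n \near \oo, c / n%:R <= p n <= 1) ->
    whp (fun n G => f n G >= r * tf n (p n)) p.

(* Main.v *)
(* Write G as the union of independent G(n, p1) and G(n, p/2), with p1 >= p/2.  Cut H
   into connected pieces of size between k = 96C/(np) and about k * Delta.  There are at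
   most n/k such pieces, so a union bound over pairs of families of pieces shows that the
   first round whp joins any two disjoint unions of pieces of size at least n/5.  Hence H
   together with the first round contains t disjoint connected chunks, each of size at
   least twice s = 96 C Delta / (np): otherwise the unused pieces would split into two
   large parts with no edge between them.  In the second round two chunks are joined with
   probability at least 1 - exp(-s^2 p) = 1 - exp(-M), independently for distinct pairs, so
   contracting the chunks gives a minor that dominates G(t, 1 - exp(-M)). *)

Require Import Defs.
From HB Require Import structures.
From mathcomp Require Import all_boot all_order all_algebra.
From mathcomp Require Import zify ring lra.
Set Implicit Arguments. Unset Strict Implicit. Unset Printing Implicit Defensive.
Import Order.TTheory GRing.Theory Num.Theory.
Local Open Scope set_scope.
Local Open Scope ring_scope.

(** * Expectations of functions of a random subset *)

(* The expectation of [F A], where [A] contains each [x] of the duplicate-free list [s]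
   independently with probability [w x]. *)
Fixpoint mean (R : realFieldType) (T : finType) (s : seq T) (w : T -> R)
    (F : {set T} -> R) : R :=
  if s is x :: s' then w x * mean s' w (fun A => F (x |: A)) + (1 - w x) * mean s' w F
  else F set0.

Lemma eq_mean (R : realFieldType) (T : finType) (s : seq T) (w : T -> R) F G :
  F =1 G -> mean s w F = mean s w G.
Proof.
elim: s F G => [|x s IH] F G FG /=; first exact: FG.
by congr (_ * _ + _ * _); apply: IH => A.
Qed.

Arguments eq_mean {R T s w F G}.

Lemma eq_in_mean (R : realFieldType) (T : finType) (s : seq T) (w w' : T -> R) F :
  {in s, w =1 w'} -> mean s w F = mean s w' F.
Proof.
elim: s F => [|x s IH] F ww //=.
have ws : {in s, w =1 w'} by move=> y ys; apply: ww; rewrite inE ys orbT.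
by rewrite ww ?mem_head// !IH.
Qed.

Arguments eq_in_mean {R T s w w' F}.

Lemma meanD (R : realFieldType) (T : finType) (s : seq T) (w : T -> R) F G :
  mean s w (fun A => F A + G A) = mean s w F + mean s w G.
Proof. by elim: s F G => [|x s IH] F G //=; rewrite !IH; ring. Qed.

Lemma meanZ (R : realFieldType) (T : finType) (s : seq T) (w : T -> R) a F :
  mean s w (fun A => a * F A) = a * mean s w F.
Proof. by elim: s F => [|x s IH] F //=; rewrite !IH; ring. Qed.

Lemma mean_cst (R : realFieldType) (T : finType) (s : seq T) (w : T -> R) a :
  mean s w (fun=> a) = a.
Proof. by elim: s => [|x s IH] //=; rewrite !IH; ring. Qed.

Lemma mean_sum (R : realFieldType) (T I : finType) (s : seq T) (w : T -> R)
    (P : pred I) (F : I -> {set T} -> R) :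
  mean s w (fun A => \sum_(i | P i) F i A) = \sum_(i | P i) mean s w (F i).
Proof.
elim: s F => [|x s IH] F //=.
by rewrite !IH !mulr_sumr -big_split.
Qed.

Lemma mean_le (R : realFieldType) (T : finType) (s : seq T) (w : T -> R) F G :
  {in s, forall x, 0 <= w x <= 1} -> (forall A : {set T}, A \subset s -> F A <= G A) ->
  mean s w F <= mean s w G.
Proof.
elim: s F G => [|x s IH] F G w01 FG /=; first by apply: FG; apply/subsetP => y; rewrite inE.
have /andP[w0 w1] := w01 x (mem_head _ _).
have ws : {in s, forall x, 0 <= w x <= 1}.
  by move=> y ys; apply: w01; rewrite inE ys orbT.
apply: lerD; apply: ler_wpM2l => //; rewrite ?subr_ge0//; apply: IH => // A As; apply: FG.
  apply/subsetP => y; rewrite !inE => /orP[->//|yA].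
  by rewrite (subsetP As) ?orbT.
by apply/subsetP => y yA; rewrite inE (subsetP As) ?orbT.
Qed.

(** An element escapes both independent random sets with probability [(1 - p) * (1 - q)], so their
    union is again a binomial random set. This identity splits [G(n, p)] into two rounds. *)
Lemma mean_union (R : realFieldType) (T : finType) (s : seq T) (p q : R) F :
  mean s (fun=> 1 - (1 - p) * (1 - q)) F =
  mean s (fun=> p) (fun A => mean s (fun=> q) (fun B => F (A :|: B))).
Proof.
elim: s F => [|x s IH] F /=; first by rewrite setU0.
rewrite !meanD !meanZ.
have -> : mean s (fun=> p) (fun A => mean s (fun=> q) (fun B => F (x |: A :|: (x |: B)))) =
    mean s (fun=> 1 - (1 - p) * (1 - q)) (fun A => F (x |: A)).
  rewrite IH; apply: eq_mean => A; apply: eq_mean => B.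
  by rewrite setUACA setUid.
have -> : mean s (fun=> p) (fun A => mean s (fun=> q) (fun B => F (x |: A :|: B))) =
    mean s (fun=> 1 - (1 - p) * (1 - q)) (fun A => F (x |: A)).
  by rewrite IH; apply: eq_mean => A; apply: eq_mean => B; rewrite setUA.
have -> : mean s (fun=> p) (fun A => mean s (fun=> q) (fun B => F (A :|: (x |: B)))) =
    mean s (fun=> 1 - (1 - p) * (1 - q)) (fun A => F (x |: A)).
  by rewrite IH; apply: eq_mean => A; apply: eq_mean => B; rewrite setUCA.
by rewrite -IH; ring.
Qed.

Lemma mean_disjoint (R : realFieldType) (T : finType) (s : seq T) (p : R) (B : {set T}) :
  mean s (fun=> p) (fun A => [disjoint A & B]%:R) = (1 - p) ^+ count (mem B) s.
Proof.
elim: s => [|x s IH] /=; first by rewrite disjoints_subset sub0set expr0.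
have dE A : [disjoint x |: A & B] = (x \notin B) && [disjoint A & B].
  by rewrite -!setI_eq0 setIUl setU_eq0 !setI_eq0 disjoints1.
rewrite (eq_mean (G := fun A => (x \notin B)%:R * [disjoint A & B]%:R)); last first.
  by move=> A; rewrite dE; case: (_ \notin _); rewrite ?mul1r ?mul0r.
rewrite meanZ IH; case: (x \in B) => /=; rewrite ?add1n ?add0n ?exprS; ring.
Qed.

(* Resampling coordinate [j] with a fresh [p]-coin. *)
Lemma mean_bump (R : realFieldType) (T : finType) (L : seq T) (w w' : T -> R) (p : R) j F :
  uniq L -> j \in L -> 1 - w' j = (1 - p) * (1 - w j) -> (forall x, x != j -> w' x = w x) ->
  mean L w' F = p * mean L w (fun A => F (j |: A)) + (1 - p) * mean L w F.
Proof.
move=> + + wj ww; elim: L F => [//|x L IH] F /= /andP[xL uL].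
have {}wj : w' j = 1 - (1 - p) * (1 - w j) by rewrite -wj; ring.
rewrite inE; case: (eqVneq j x) => [jx _|jx /= jL].
  subst x.
  have wL G : mean L w' G = mean L w G.
    by apply: eq_in_mean => y yL; apply: ww; apply: contraTneq yL => ->.
  rewrite !wL (eq_mean (F := fun A => F (j |: (j |: A))) (G := fun A => F (j |: A))).
    by rewrite wj; ring.
  by move=> A; rewrite setUA setUid.
rewrite !IH// ww 1?eq_sym//.
rewrite (eq_mean (F := fun A => F (j |: (x |: A))) (G := fun A => F (x |: (j |: A)))).
  by ring.
by move=> A; rewrite setUCA.
Qed.

(** A label [j] is missed exactly when all elements of [s] carrying it are missed, and distinct
    labels depend on disjoint sets of elements, so labels occur independently. Labels outside [L]
    are invisible to [F]. *)
Lemma mean_imset (R : realFieldType) (T J : finType) (g : T -> J) (L : seq J) (s : seq T)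
    (p : R) (F : {set J} -> R) :
  uniq L -> (forall j A, j \notin L -> F (j |: A) = F A) ->
  mean s (fun=> p) (fun A => F (g @: A)) =
  mean L (fun j => 1 - (1 - p) ^+ count (fun x => g x == j) s) F.
Proof.
move=> uL; elim: s F => [|x s IH] F FL /=.
  rewrite imset0; rewrite (eq_in_mean (w' := fun=> 0)); last first.
    by move=> j _; rewrite expr0 subrr.
  elim: L F {uL FL} => [//|j L IH] F /=.
  by rewrite mul0r add0r subr0 mul1r.
rewrite (eq_mean (F := fun A => F (g @: (x |: A))) (G := fun A => F (g x |: g @: A))); last first.
  by move=> A; rewrite imsetU1.
have [gL|gL] := boolP (g x \in L); last first.
  rewrite (eq_mean (F := fun A => F (g x |: g @: A)) (G := fun A => F (g @: A))); last first.
    by move=> A; rewrite FL.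
  rewrite IH// -mulrDl addrC subrK mul1r; apply: eq_in_mean => j jL.
  by rewrite (_ : (g x == j) = false)//; apply: contraNF gL => /eqP ->.
rewrite (IH (fun A => F (g x |: A))); last first.
  by move=> j A jL; rewrite setUCA FL.
(* Revealing [x] amounts to one more [p]-coin for the single label [g x]. *)
rewrite IH//; apply/esym; apply: mean_bump => //.
  by rewrite eqxx add1n exprS; ring.
by move=> j; rewrite eq_sym => /negPf ->.
Qed.

(** A union bound over the elements of [L] that may be missing. *)
Lemma mean_ge_all (R : realFieldType) (T : finType) (L : seq T) (q : R) (F : {set T} -> R) :
  0 <= q <= 1 -> (forall A, 0 <= F A) ->
  (forall A : {set T}, {subset L <= A} -> 1 <= F A) ->
  1 - (size L)%:R * (1 - q) <= mean L (fun=> q) F.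
Proof.
move=> /andP[q0 q1]; elim: L F => [|x L IH] F F0 F1 /=.
  by rewrite mul0r subr0; apply: F1.
have m1 : 1 - (size L)%:R * (1 - q) <= mean L (fun=> q) (fun A => F (x |: A)).
  apply: IH => // A LA; apply: F1 => y; rewrite !inE => /orP[->//|/LA ->].
  by rewrite orbT.
have m2 : 0 <= mean L (fun=> q) F.
  by rewrite -[leLHS](mean_cst L (fun=> q)); apply: mean_le => // ? _; apply/andP.
have := ler_wpM2l q0 m1.
have q' : 0 <= 1 - q by rewrite subr_ge0.
have := mulr_ge0 q' m2.
have : 0 <= (size L)%:R * (1 - q) * (1 - q) by rewrite !mulr_ge0.
rewrite -natr1; nra.
Qed.

(** Weights change one coordinate at a time: shifting mass from [x] absent to [x] present can only
    raise a monotone [F]. *)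
Lemma mean_mono (R : realFieldType) (T : finType) (L : seq T) (w w' : T -> R) F :
  {in L, forall x, 0 <= w x <= 1} -> {in L, forall x, 0 <= w' x <= 1} ->
  {in L, forall x, w x <= w' x} ->
  (forall A B : {set T}, A \subset B -> F A <= F B) -> mean L w F <= mean L w' F.
Proof.
elim: L F => [//|x L IH] F h h' hw Fm /=.
have inL y : y \in L -> y \in x :: L by rewrite inE => ->; rewrite orbT.
have m1 : mean L w (fun A => F (x |: A)) <= mean L w' (fun A => F (x |: A)).
  apply: IH => [y /inL/h|y /inL/h'|y /inL/hw|A B AB] //.
  by apply: Fm; rewrite setUS.
have m2 : mean L w F <= mean L w' F by apply: IH => [y /inL/h|y /inL/h'|y /inL/hw|].
have m3 : mean L w' F <= mean L w' (fun A => F (x |: A)).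
  by apply: mean_le => [y /inL/h'//|A _]; apply: Fm; rewrite subsetUr.
have /andP[a0 a1] := h x (mem_head _ _).
have /andP[b0 b1] := h' x (mem_head _ _).
have ab := hw x (mem_head _ _).
have := ler_wpM2l a0 m1.
have q' : 0 <= 1 - w x by rewrite subr_ge0.
have := ler_wpM2l q' m2.
have ab' : 0 <= w' x - w x by rewrite subr_ge0.
have := ler_wpM2l ab' m3.
lra.
Qed.

(** Links the recursive expectation to the explicit weights used in [PrGnp]. *)
Lemma meanE (R : realFieldType) (T : finType) (s : seq T) (p : R) (F : {set T} -> R) :
  uniq s ->
  mean s (fun=> p) F =
  \sum_(E : {set T} | E \subset s) p ^+ #|E| * (1 - p) ^+ (size s - #|E|) * F E.
Proof.
elim: s F => [|x s IH] F /=.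
  rewrite (big_pred1 set0) ?cards0 ?expr0 ?mul1r// => E.
  apply/idP/eqP => [E0|->]; last by apply/subsetP => y; rewrite inE.
  by apply/setP => y; rewrite inE; apply/negP => /(subsetP E0).
move=> /andP[xs us]; rewrite !IH// [RHS](bigID (fun E : {set T} => x \in E)) /=.
have cs (E : {set T}) : E \subset s -> (#|E| <= size s)%N.
  by move=> Es; rewrite -(card_uniqP us); apply: subset_leq_card.
have nx (E : {set T}) : E \subset s -> x \notin E.
  by move=> Es; apply: contraNN xs; apply: (subsetP Es).
congr (_ + _).
  rewrite [in RHS](reindex_onto (fun E => x |: E) (fun E => E :\ x)) /=; last first.
    by move=> E /andP[_ xE]; rewrite setD1K.
  rewrite mulr_sumr; apply: eq_big => E.
    rewrite setU11 andbT; apply/idP/andP => [Es|[xEs /eqP xE]].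
      rewrite setU1K ?nx//; split=> //; apply/subsetP => y.
      by rewrite !inE => /orP[->//|/(subsetP Es) ->]; rewrite orbT.
    apply/subsetP => y yE; have yx : y \in x |: E by rewrite inE yE orbT.
    have := subsetP xEs y yx; rewrite inE => /orP[/eqP yx'|//].
    by move: yE; rewrite -xE yx' !inE eqxx.
  by move=> Es; rewrite cardsU1 nx// add1n exprS subSS; ring.
rewrite mulr_sumr; apply: eq_big => E.
  apply/idP/andP => [Es|[Es xE]].
    by rewrite nx//; split=> //; apply/subsetP => y /(subsetP Es); rewrite inE => ->; rewrite orbT.
  apply/subsetP => y yE; have := subsetP Es y yE; rewrite inE => /orP[/eqP yx|//].
  by rewrite -yx yE in xE.
by move=> Es; rewrite subSn ?cs// exprS; ring.
Qed.

(** * Connected pieces of a graph of bounded degree *)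

(** The relation that [connected_in] writes inline, named so that lemmas about [connect] can be
    stated for it. *)
Definition induced n (E : sgraph n) (S : {set 'I_n}) : rel 'I_n :=
  [rel u v | [&& u \in S, v \in S & adj E u v]].

Lemma inducedE n (E : sgraph n) S u v :
  induced E S u v = [&& u \in S, v \in S & adj E u v].
Proof. by []. Qed.

Definition connectedb n (E : sgraph n) (S : {set 'I_n}) : bool :=
  [forall x, forall y, (x \in S) ==> (y \in S) ==> connect (induced E S) x y].

Lemma connectedP n (E : sgraph n) (S : {set 'I_n}) :
  reflect (connected_in E S) (connectedb E S).
Proof.
apply: (iffP idP) => [/forallP h x y xS yS|h].
  by have /forallP/(_ y)/implyP/(_ xS)/implyP/(_ yS) := h x.
apply/forallP => x; apply/forallP => y; apply/implyP => xS; apply/implyP => yS.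
exact: h.
Qed.

Lemma adj_sym n (E : sgraph n) : symmetric (adj E).
Proof. by move=> x y; rewrite /adj eq_sym setUC. Qed.

Lemma adjS n (E E' : sgraph n) x y : E \subset E' -> adj E x y -> adj E' x y.
Proof. by move=> EE' /andP[xy xyE]; rewrite /adj xy (subsetP EE'). Qed.

Lemma connect_induced_sym n (E : sgraph n) S : connect_sym (induced E S).
Proof.
by apply: sym_connect_sym => x y; rewrite !inducedE [adj E y x]adj_sym andbCA.
Qed.

Lemma connect_inducedS n (E E' : sgraph n) (S S' : {set 'I_n}) x y :
  E \subset E' -> S \subset S' -> connect (induced E S) x y -> connect (induced E' S') x y.
Proof.
move=> EE' SS'; apply: connect_sub => {x y} x y /and3P[xS yS xy]; apply: connect1.
by rewrite inducedE !(subsetP SS')// (adjS EE').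
Qed.

Lemma connected_inS n (E E' : sgraph n) (S : {set 'I_n}) :
  E \subset E' -> connected_in E S -> connected_in E' S.
Proof. by move=> EE' cS x y xS yS; apply: connect_inducedS EE' _ (cS x y xS yS). Qed.

Lemma connected_in_hub n (E : sgraph n) (S : {set 'I_n}) v :
  (forall x, x \in S -> connect (induced E S) x v) -> connected_in E S.
Proof.
move=> Sv x y xS yS; apply: connect_trans (Sv x xS) _.
by rewrite -/(induced E S) connect_induced_sym; apply: Sv.
Qed.

Lemma connected_inU n (E : sgraph n) (A B : {set 'I_n}) u v :
  connected_in E A -> connected_in E B -> u \in A -> v \in B -> adj E u v ->
  connected_in E (A :|: B).
Proof.
move=> cA cB uA vB uv; apply: (@connected_in_hub _ _ _ v) => x.
rewrite inE => /orP[xA|xB].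
  apply: (@connect_trans _ _ u).
    exact: connect_inducedS (subxx _) (subsetUl _ _) (cA x u xA uA).
  by apply: connect1; rewrite inducedE !inE uA vB orbT.
exact: connect_inducedS (subxx _) (subsetUr _ _) (cB x v xB vB).
Qed.

Lemma connected_in1 n (E : sgraph n) v : connected_in E [set v].
Proof. by move=> x y; rewrite !inE => /eqP -> /eqP ->; apply: connect0. Qed.

(** Without such an edge [A] would be closed under adjacency in [S], so no path in [S] could lead
    from [x] to [y]. *)
Lemma crossing_edge n (E : sgraph n) (S A : {set 'I_n}) x y :
  connected_in E S -> A \subset S -> x \in A -> y \in S -> y \notin A ->
  exists u v, [/\ u \in A, v \in S :\: A & adj E u v].
Proof.
move=> cS AS xA yS yA.
have [/existsP[u /existsP[v /and3P[uA vA uv]]]|nE] :=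
  boolP [exists u, exists v, [&& u \in A, v \in S :\: A & adj E u v]].
  by exists u, v.
have cl : closed (induced E S) A.
  apply: intro_closed; first exact: connect_induced_sym.
  move=> u v /and3P[uS vS uv] uA; apply: contraNT nE => vA.
  by apply/existsP; exists u; apply/existsP; exists v; rewrite !inE uA vA vS.
have := closed_connect cl (cS x y (subsetP AS _ xA) yS).
by rewrite xA (negPf yA).
Qed.

Definition component n (E : sgraph n) (S : {set 'I_n}) x : {set 'I_n} :=
  [set y | connect (induced E S) x y].

Lemma component_sub n (E : sgraph n) (S : {set 'I_n}) x :
  x \in S -> component E S x \subset S.
Proof.
move=> xS; apply/subsetP => y; rewrite inE => xy.
have cl : closed (induced E S) S by move=> u v /and3P[-> ->].
by rewrite -(closed_connect cl xy).
Qed.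

(** Every vertex on a path in [S] from [x] is itself reached from [x], so the path stays in the
    component. *)
Lemma component_connected n (E : sgraph n) (S : {set 'I_n}) x :
  connected_in E (component E S x).
Proof.
apply: (@connected_in_hub _ _ _ x) => y; rewrite connect_induced_sym inE.
move=> /connectP[p]; elim/last_ind: p y => [|p z IH] y /=; first by move=> _ ->.
rewrite rcons_path last_rcons => /andP[xp zp] ->.
apply: (connect_trans (IH _ xp erefl)); apply: connect1; rewrite inducedE !inE.
have /and3P[_ _ ->] := zp; rewrite andbT; apply/andP; split; first by apply/connectP; exists p.
by apply: (@connect_trans _ _ (last x p)); [apply/connectP; exists p|exact: connect1].
Qed.

Lemma component_disjoint n (E : sgraph n) (S : {set 'I_n}) x y :
  y \notin component E S x -> [disjoint component E S y & component E S x].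
Proof.
move=> yx; rewrite -setI_eq0; apply/set0Pn => -[z]; rewrite !inE => /andP[yz xz].
move: yx; rewrite inE => /negP; apply; apply: connect_trans xz _.
by rewrite connect_induced_sym.
Qed.

(** Since [T] is connected, an edge leaves the component within [T]; an endpoint other than [v]
    would still belong to the component. *)
Lemma component_to_hub n (E : sgraph n) (T : {set 'I_n}) v x :
  connected_in E T -> v \in T -> x \in T :\ v ->
  exists2 u, u \in component E (T :\ v) x & adj E u v.
Proof.
move=> cT vT xT.
have sub := component_sub E xT.
have vN : v \notin component E (T :\ v) x by apply/negP => /(subsetP sub); rewrite !inE eqxx.
have xx : x \in component E (T :\ v) x by rewrite inE connect0.
have [u [w [uA wA uw]]] := crossing_edge cT (subset_trans sub (subsetDl _ _)) xx vT vN.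
have [wv|wv] := eqVneq w v; first by exists u => //; rewrite -wv.
exfalso; move: wA; rewrite inE => /andP[/negP wN wT]; apply: wN.
have uT := subsetP sub _ uA.
move: uA; rewrite !inE => xu; apply: connect_trans xu _; apply: connect1.
by rewrite inducedE uT !inE wv wT.
Qed.

(* A large component [K] of [T :\ v] would contradict the minimality of [T], since
   removing [K] leaves [S] connected through [v]. *)
Lemma cut_piece n (E : sgraph n) (S : {set 'I_n}) d k :
  (0 < k)%N -> (forall v, #|[set u | adj E v u]| <= d)%N ->
  connected_in E S -> (k <= #|S|)%N ->
  exists T : {set 'I_n}, [/\ T \subset S, (k <= #|T|)%N, (#|T| <= 1 + d * k.-1)%N,
     connected_in E T & connected_in E (S :\: T)].
Proof.
move=> k0 dE cS kS.
pose P (T : {set 'I_n}) := [&& T \subset S, (k <= #|T|)%N,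
   connectedb E T & connectedb E (S :\: T)].
have PS : P S.
  apply/and4P; split=> //; first exact/connectedP.
  by apply/connectedP; rewrite setDv => x y; rewrite inE.
have [T /minsetP[/and4P[TS kT /connectedP cT /connectedP cST] Tmin] _] := minset_exists PS.
exists T; split=> //.
(* Pick [v] in [T] with a neighbour in [S :\: T]. If [S :\: T] is empty the requirement is vacuous
   and any vertex of [T] serves. *)
have [v vT hub] : exists2 v, v \in T & forall x, x \in S :\: T ->
   exists2 w, w \in S :\: T & adj E w v.
  have [z zT] : exists z, z \in T by apply/set0Pn; rewrite -card_gt0; lia.
  have [ST0|[x xST]] := set_0Vmem (S :\: T).
    by exists z => // x; rewrite ST0 inE.
  have [] := crossing_edge (A := S :\: T) cS (subsetDl _ _) xST (subsetP TS _ zT).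
    by rewrite inE zT.
  move=> w [v [wS vS wv]]; exists v; first by move: vS; rewrite !inE; case: (v \in T) => //=; case: (_ \in S).
  by move=> _ _; exists w.
have small x : x \in T :\ v -> (#|component E (T :\ v) x| <= k.-1)%N.
  move=> xT; set K := component _ _ _; rewrite leqNgt; apply/negP => kK.
  have KT : K \subset T :\ v := component_sub E xT.
  have KT' : K \subset T := subset_trans KT (subsetDl _ _).
  have vSK : v \in S :\: K.
    by rewrite inE (subsetP TS)// andbT; apply/negP => /(subsetP KT); rewrite !inE eqxx.
  have PK : P K.
    apply/and4P; split; [exact: subset_trans TS|lia|apply/connectedP; exact: component_connected|].
    apply/connectedP; apply: (@connected_in_hub _ _ _ v) => y; rewrite inE => /andP[yK yS].
    have [->|yv] := eqVneq y v; first exact: connect0.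
    have [yT|yT] := boolP (y \in T).
      have yTv : y \in T :\ v by rewrite !inE yv.
      have [u uy uv] := component_to_hub cT vT yTv.
      have cy : component E (T :\ v) y \subset S :\: K.
        rewrite subsetD component_disjoint// andbT.
        exact: subset_trans (component_sub E yTv) (subset_trans (subsetDl _ _) TS).
      apply: (@connect_trans _ _ u).
        apply: connect_inducedS (subxx _) cy _.
        by apply: (@component_connected _ E (T :\ v) y) => //; rewrite inE connect0.
      by apply: connect1; rewrite inducedE vSK uv (subsetP cy).
    have yST : y \in S :\: T by rewrite inE yT.
    have [w wST wv] := hub y yST.
    have sub : S :\: T \subset S :\: K by apply: setDS.
    apply: (@connect_trans _ _ w).
      by apply: connect_inducedS (subxx _) sub _; apply: cST.
    by apply: connect1; rewrite inducedE vSK wv (subsetP sub).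
  have KE := Tmin K PK KT'.
  by move: KT; rewrite KE => /subsetP/(_ v vT); rewrite !inE eqxx.
(* Each component of [T :\ v] contains a neighbour of [v], so there are at most [d] of them, each
   with at most [k - 1] vertices. *)
pose N := [set u in T :\ v | adj E v u].
have TN : T \subset v |: \bigcup_(u in N) component E (T :\ v) u.
  apply/subsetP => x xT; rewrite !inE; have [//|xv /=] := eqVneq x v.
  have xTv : x \in T :\ v by rewrite !inE xv.
  have [u ux uv] := component_to_hub cT vT xTv.
  apply/bigcupP; exists u; last by move: ux; rewrite !inE connect_induced_sym.
  by rewrite inE (subsetP (component_sub E xTv) _ ux) adj_sym.
have Nd : (#|N| <= d)%N.
  apply: leq_trans (dE v); apply: subset_leq_card; apply/subsetP => u.
  by rewrite !inE => /andP[].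
apply: leq_trans (subset_leq_card TN) _.
rewrite cardsU1; apply: leq_add; first by case: (_ \notin _).
have bc : (#|\bigcup_(u in N) component E (T :\ v) u| <= \sum_(u in N) #|component E (T :\ v) u|)%N.
  elim/big_rec2: _ => [|u m B _ le]; first by rewrite cards0.
  by apply: leq_trans (leq_card_setU _ _) _; rewrite leq_add2l.
apply: leq_trans bc _; apply: (@leq_trans (\sum_(u in N) k.-1)%N).
  by apply: leq_sum => u; rewrite inE => /andP[uT _]; apply: small.
by rewrite sum_nat_const leq_mul2r Nd orbT.
Qed.

(** Pieces are cut off one after another. What remains stays connected, so this goes on until fewer
    than [k] vertices are left. *)
Lemma piece_packing n (E : sgraph n) (S : {set 'I_n}) d k :
  (0 < d)%N -> (0 < k)%N -> (forall v, #|[set u | adj E v u]| <= d)%N ->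
  connected_in E S ->
  exists P : {set {set 'I_n}}, [/\ trivIset P, cover P \subset S, (#|S| < #|cover P| + k)%N &
    forall A, A \in P -> [/\ connected_in E A, (k <= #|A|)%N & (#|A| <= d * k)%N]].
Proof.
move=> d0 k0 dE; have [m] := ubnP #|S|; elim: m S => [//|m IH] S Sm cS.
have [Sk|kS] := ltnP #|S| k.
  exists set0; split; first by apply/trivIsetP => A B; rewrite inE.
  - by rewrite /cover big_set0 sub0set.
  - by rewrite /cover big_set0 cards0.
  - by move=> A; rewrite inE.
have [T [TS kT Td cT cST]] := cut_piece k0 dE cS kS.
have cardST : #|S| = (#|T| + #|S :\: T|)%N by rewrite -(cardsID T S) (setIidPr TS).
have [|P [tP sP cP hP]] := IH (S :\: T) _ cST; first lia.
have TP : [disjoint T & cover P].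
  by rewrite disjoint_sym; apply: disjointWl sP _; rewrite -setI_eq0 setIDAC setDIl setDv setI0.
have T0 : set0 != T by rewrite eq_sym -card_gt0; lia.
have N0 : set0 \notin P by apply/negP => /hP[_]; rewrite cards0; lia.
have [tTP _] : trivIset (T |: P) /\ T \notin P.
  apply: trivIsetU1 => // B BP; apply: disjointWr TP; exact: bigcup_sup BP.
exists (T |: P); split=> //.
- rewrite /cover bigcup_setU big_set1 subUset TS /=.
  exact: subset_trans sP (subsetDl _ _).
- rewrite /cover bigcup_setU big_set1 -/(cover P) cardsU (disjoint_setI0 TP) cards0; lia.
- move=> A; rewrite !inE => /orP[/eqP ->|/hP//]; split=> //.
  (* Here [1 + d * (k - 1) <= d * k] because [d] is positive. *)
  by apply: leq_trans Td _; case: k k0 {kS kT cP hP IH} => //= k _; nia.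
Qed.

(** * Chunks and their contraction *)

Lemma disjoint_cover (T : finType) (P Q1 Q2 : {set {set T}}) :
  trivIset P -> Q1 \subset P -> Q2 \subset P -> [disjoint Q1 & Q2] ->
  [disjoint cover Q1 & cover Q2].
Proof.
move=> /trivIsetP tP Q1P Q2P dQ; rewrite -setI_eq0; apply/set0Pn => -[x].
rewrite inE => /andP[/bigcupP[A A1 xA] /bigcupP[B B2 xB]].
have AB : A != B by apply: contraTneq A1 => ->; rewrite (disjointFl dQ B2).
have := tP A B (subsetP Q1P _ A1) (subsetP Q2P _ B2) AB.
by move=> /disjointFr /(_ xA); rewrite xB.
Qed.

Lemma card_cover_split (T : finType) (P Q W : {set {set T}}) :
  trivIset P -> W \subset P -> Q \subset W ->
  #|cover W| = (#|cover Q| + #|cover (W :\: Q)|)%N.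
Proof.
move=> tP WP QW.
have c (V : {set {set T}}) : V \subset P -> #|cover V| = (\sum_(A in V) #|A|)%N.
  by move=> VP; apply/esym/eqP; apply: trivIsetS VP tP.
rewrite !c//; last first.
- exact: subset_trans QW WP.
- exact: subset_trans (subsetDl _ _) WP.
by rewrite (big_setID Q) /= (setIidPr QW).
Qed.

Lemma coverS (T : finType) (Q W : {set {set T}}) : Q \subset W -> cover Q \subset cover W.
Proof. by move=> QW; apply/bigcupsP => A /(subsetP QW) AW; apply: bigcup_sup AW. Qed.

Lemma coverU1 (T : finType) (A : {set T}) Q : cover (A |: Q) = A :|: cover Q.
Proof. by rewrite /cover bigcup_setU big_set1. Qed.

(** Only unions of pieces are tested, not arbitrary vertex sets; this keeps the number of pairs in
    the union bound at most [4 ^ #|P|]. *)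
Definition expands n (G : sgraph n) (P : {set {set 'I_n}}) (m : nat) : bool :=
  [forall Q1 : {set {set 'I_n}}, forall Q2 : {set {set 'I_n}},
    [&& Q1 \subset P, Q2 \subset P, [disjoint Q1 & Q2],
        (m <= #|cover Q1|)%N & (m <= #|cover Q2|)%N] ==>
    [exists u in cover Q1, exists v in cover Q2, adj G u v]].

Lemma expandsP n (G : sgraph n) (P : {set {set 'I_n}}) m :
  reflect (forall Q1 Q2 : {set {set 'I_n}}, Q1 \subset P -> Q2 \subset P ->
     [disjoint Q1 & Q2] -> (m <= #|cover Q1|)%N -> (m <= #|cover Q2|)%N ->
     exists u v, [/\ u \in cover Q1, v \in cover Q2 & adj G u v])
   (expands G P m).
Proof.
apply: (iffP idP) => [/forallP h Q1 Q2 h1 h2 h3 h4 h5|h].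
  move: (h Q1) => /forallP/(_ Q2); rewrite h1 h2 h3 h4 h5 /=.
  by move=> /existsP[u /andP[uQ /existsP[v /andP[vQ uv]]]]; exists u, v.
apply/forallP => Q1; apply/forallP => Q2; apply/implyP => /and5P[h1 h2 h3 h4 h5].
have [u [v [uQ vQ uv]]] := h Q1 Q2 h1 h2 h3 h4 h5.
by apply/existsP; exists u; rewrite uQ; apply/existsP; exists v; rewrite vQ.
Qed.

(* [Z] is a maximal union of components of the graph on [W] that is too small to be
   separated from the rest; a maximal connected [Q] outside [Z] then has to be large. *)
Lemma exists_chunk n (E : sgraph n) (P W : {set {set 'I_n}}) b m :
  trivIset P -> (forall A, A \in P -> connected_in E A /\ (#|A| <= b)%N) ->
  expands E P m -> W \subset P -> (0 < m)%N -> (2 * m + 2 * b <= #|cover W|)%N ->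
  exists Q : {set {set 'I_n}}, [/\ Q \subset W, connected_in E (cover Q),
     (2 * b <= #|cover Q|)%N & (#|cover Q| <= 3 * b)%N].
Proof.
move=> tP hP /expandsP eP WP m0 hW.
have sP (V : {set {set 'I_n}}) : V \subset W -> V \subset P by move=> VW; apply: subset_trans WP.
pose closedZ (Z : {set {set 'I_n}}) := [&& Z \subset W, (#|cover Z| < m)%N &
  [forall u in cover Z, forall v in cover (W :\: Z), ~~ adj E u v]].
have closedP (Z : {set {set 'I_n}}) :
    reflect (forall u v, u \in cover Z -> v \in cover (W :\: Z) -> ~~ adj E u v)
     [forall u in cover Z, forall v in cover (W :\: Z), ~~ adj E u v].
  apply: (iffP idP) => [/forallP h u v uZ vZ|h].
    by have /implyP/(_ uZ)/forallP/(_ v)/implyP/(_ vZ) := h u.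
  apply/forallP => u; apply/implyP => uZ; apply/forallP => v; apply/implyP => vZ; exact: h.
have c0 : closedZ set0.
  apply/and3P; split; [exact: sub0set|by rewrite /cover big_set0 cards0|].
  by apply/closedP => u v; rewrite /cover big_set0 inE.
have [Z /maxsetP[/and3P[ZW Zm /closedP Zc] Zmax] _] := maxset_exists c0.
have cW := card_cover_split tP WP ZW.
have [X XWZ] : exists X, X \in W :\: Z.
  apply/set0Pn; apply: contraTneq hW => WZ0; rewrite cW WZ0 {2}/cover big_set0 cards0; move: Zm m0; clear; lia.
pose conn (Q : {set {set 'I_n}}) := [&& X \in Q, Q \subset W :\: Z, (#|cover Q| <= 2 * b)%N &
  connectedb E (cover Q)].
have XP : X \in P by apply: (subsetP WP); move: XWZ; rewrite inE => /andP[].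
have cX : conn [set X].
  have cvX : cover [set X] = X by rewrite /cover big_set1.
  apply/and4P; split; rewrite ?set11 ?sub1set ?cvX//.
    by have [_] := hP X XP; clear; lia.
  by apply/connectedP; case: (hP X XP).
have [Q /maxsetP[/and4P[XQ QWZ Qb /connectedP Qc] Qmax] _] := maxset_exists cX.
have QW : Q \subset W by apply: subset_trans QWZ (subsetDl _ _).
(* If a further piece [Y] touches [Q], then [Y |: Q] is connected, exceeds [2 * b] by maximality of
   [Q], and gains at most [b] vertices from [Y]. *)
have [/existsP[u /existsP[v /and3P[uQ vY uv]]]|nE] :=
  boolP [exists u, exists v, [&& u \in cover Q, v \in cover ((W :\: Z) :\: Q) & adj E u v]].
  have /bigcupP[Y YWZ vYY] := vY.
  have YP : Y \in P by apply: (subsetP WP); move: YWZ; rewrite !inE => /and3P[].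
  have [Yc Yb] := hP Y YP.
  have cQY : connected_in E (cover (Y |: Q)).
    by rewrite coverU1 setUC; apply: connected_inU Qc Yc uQ vYY uv.
  have cardQY : (#|cover (Y |: Q)| <= #|Y| + #|cover Q|)%N.
    by rewrite coverU1; apply: leq_card_setU.
  exists (Y |: Q); split=> //.
  - by rewrite subUset QW sub1set andbT; move: YWZ; rewrite !inE => /and3P[].
  - rewrite leqNgt; apply/negP => lt.
    have QY : Y |: Q = Q.
      apply: Qmax; last exact: subsetUr.
      apply/and4P; split; last exact/connectedP.
      + by rewrite inE XQ orbT.
      + by rewrite subUset QWZ sub1set andbT; move: YWZ; rewrite inE => /andP[].
      + exact: ltnW.
    by move: YWZ; rewrite -QY !inE eqxx.
  - by move: cardQY Qb Yb; clear; lia.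
(* Otherwise no edge joins [Z :|: Q] to the rest of [W]. If this union is below [m], it contradicts
   maximality of [Z]. If not, it still covers fewer than [m + 2 * b] vertices, so at least [m]
   remain and expansion yields a forbidden edge. *)
have ZQW : Z :|: Q \subset W by rewrite subUset ZW.
have ZQc u v : u \in cover (Z :|: Q) -> v \in cover (W :\: (Z :|: Q)) -> ~~ adj E u v.
  rewrite {1}/cover bigcup_setU inE => uZQ vW; have := vW; rewrite setDUr.
  move=> /bigcupP[Y]; rewrite inE => /andP[YZ YQ] vY.
  case/orP: uZQ => [uZ|uQ].
    by apply: Zc => //; apply/bigcupP; exists Y.
  apply: contraNN nE => uv; apply/existsP; exists u; apply/existsP; exists v.
  rewrite uQ uv andbT; apply/bigcupP; exists Y => //.
  by move: YZ YQ; rewrite !inE => /andP[-> ->] /andP[-> _].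
have cZQ : (#|cover (Z :|: Q)| <= #|cover Z| + #|cover Q|)%N.
  by rewrite /cover bigcup_setU; apply: leq_card_setU.
have cW' := card_cover_split tP WP ZQW.
have [lt|ge] := ltnP #|cover (Z :|: Q)| m.
  have ZQ : Z :|: Q = Z.
    by apply: Zmax; [apply/and3P; split=> //; apply/closedP|apply: subsetUl].
  by move: XWZ; rewrite -ZQ !inE XQ orbT.
have [|||u [v [uZ vW uv]]] := eP _ (W :\: (Z :|: Q)) (sP _ ZQW) _ _ ge.
- exact: subset_trans (subsetDl _ _) WP.
- by rewrite -setI_eq0 setIC setIDAC setDIl setDv setI0.
- by move: cW' hW cZQ Zm Qb; clear; lia.
- by have := ZQc u v uZ vW; rewrite uv.
Qed.

(** Greedy extraction: a chunk uses at most [3 * b] vertices, so at least [2 * m + 2 * b] are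
    available each time another one is needed. *)
Lemma exists_chunks n (E : sgraph n) (P : {set {set 'I_n}}) b m t (W : {set {set 'I_n}}) :
  trivIset P -> (forall A, A \in P -> connected_in E A /\ (#|A| <= b)%N) ->
  expands E P m -> (0 < m)%N -> W \subset P ->
  (2 * m + 2 * b + 3 * b * t <= #|cover W|)%N ->
  exists S : 'I_t -> {set 'I_n}, [/\ forall i, S i \subset cover W,
    forall i, connected_in E (S i), forall i, (2 * b <= #|S i|)%N &
    forall i j, i != j -> [disjoint S i & S j]].
Proof.
move=> tP hP eP m0; elim: t W => [|t IH] W WP hW.
  by exists (fun=> set0); split=> [] [].
have [|Q [QW Qc Qb Qb3]] := exists_chunk (b := b) tP hP eP WP m0; first lia.
have cW := card_cover_split tP WP QW.
have [||S [SW Sc Sb Sd]] := IH (W :\: Q); first exact: subset_trans (subsetDl _ _) WP.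
  by lia.
have QS i : [disjoint cover Q & S i].
  apply: disjointWr (SW i) _; apply: disjoint_cover tP (subset_trans QW WP) _ _.
    exact: subset_trans (subsetDl _ _) WP.
  by rewrite -setI_eq0 setIC setIDAC setDIl setDv setI0.
exists (fun i => if unlift ord0 i is Some k then S k else cover Q); split.
- move=> i; case: unliftP => [k _|_].
    by apply: subset_trans (SW k) (coverS (subsetDl _ _)).
  exact: coverS.
- by move=> i; case: unliftP.
- by move=> i; case: unliftP.
- move=> i j; case: unliftP => [k ->|->]; case: unliftP => [l ->|->] //; rewrite ?eqxx// => ij.
  + by apply: Sd; apply: contraNneq ij => ->.
  + by rewrite disjoint_sym.
Qed.

(** * Edges between disjoint sets, and expansion of the first round *)

Definition cross n (A B : {set 'I_n}) : {set {set 'I_n}} :=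
  [set [set uv.1; uv.2] | uv in setX A B].

Lemma card_cross n (A B : {set 'I_n}) : [disjoint A & B] -> #|cross A B| = (#|A| * #|B|)%N.
Proof.
move=> dAB; rewrite card_in_imset ?cardsX//.
move=> [u v] [u' v']; rewrite !in_setX /= => /andP[uA vB] /andP[uA' vB'] e.
have ne x y : x \in A -> y \in B -> x != y.
  by move=> xA yB; apply: contraTneq xA => ->; rewrite (disjointFl dAB).
have : u \in [set u'; v'] by rewrite -e set21.
have : v \in [set u'; v'] by rewrite -e set22.
rewrite !inE (negPf (ne _ _ uA vB')) orbF [v == u']eq_sym (negPf (ne _ _ uA' vB)) /=.
by move=> /eqP -> /eqP ->.
Qed.

Lemma cross_complete n (A B : {set 'I_n}) : [disjoint A & B] -> cross A B \subset complete_graph n.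
Proof.
move=> dAB; apply/subsetP => e /imsetP[[u v]]; rewrite in_setX /= => /andP[uA vB] ->.
rewrite inE cards2; suff -> : u != v by [].
by apply: contraTneq uA => ->; rewrite (disjointFl dAB).
Qed.

Lemma count_enum (T : finType) (A : {set T}) (a : pred T) :
  count a (enum A) = #|[set x in A | a x]|.
Proof.
rewrite -size_filter cardE; apply: perm_size; apply: uniq_perm.
- by rewrite filter_uniq ?enum_uniq.
- exact: enum_uniq.
- by move=> x; rewrite mem_filter !mem_enum inE andbC.
Qed.

Lemma no_cross_edge n (G : sgraph n) (A B : {set 'I_n}) :
  [disjoint A & B] -> (forall u v, u \in A -> v \in B -> ~~ adj G u v) -> [disjoint G & cross A B].
Proof.
move=> dAB h; rewrite -setI_eq0; apply/set0Pn => -[e]; rewrite inE => /andP[eG].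
move=> /imsetP[[u v]]; rewrite in_setX /= => /andP[uA vB] ee.
have := h u v uA vB; rewrite /adj -ee eG andbT negbK => /eqP uv.
by move: vB; rewrite -uv (disjointFr dAB uA).
Qed.

(** If expansion fails, some pair of disjoint subfamilies has all of its at least [m * m] potential
    cross edges absent; then comes a union bound over the pairs. *)
Lemma mean_expands (R : realFieldType) n (P : {set {set 'I_n}}) m (p : R) :
  0 <= p <= 1 -> trivIset P ->
  1 - (4 ^ #|P|)%:R * (1 - p) ^+ (m * m) <=
  mean (enum (complete_graph n)) (fun=> p) (fun G => (expands G P m)%:R).
Proof.
move=> p01 tP; have /andP[p0 p1] := p01.
pose V (Q : {set {set 'I_n}} * {set {set 'I_n}}) :=
  [&& Q.1 \subset P, Q.2 \subset P, [disjoint Q.1 & Q.2],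
        (m <= #|cover Q.1|)%N & (m <= #|cover Q.2|)%N].
pose bad Q (G : sgraph n) : R := [disjoint G & cross (cover Q.1) (cover Q.2)]%:R.
apply: (@le_trans _ _ (mean (enum (complete_graph n)) (fun=> p)
   (fun G => 1 + (- 1) * \sum_(Q | V Q) bad Q G))); last first.
  apply: mean_le => // G _; case eG : (expands G P m).
    by rewrite mulN1r gerBl; apply: sumr_ge0.
  have : ~~ expands G P m by rewrite eG.
  rewrite /expands negb_forall => /existsP[Q1]; rewrite negb_forall => /existsP[Q2].
  rewrite negb_imply => /andP[VQ nQ].
  rewrite mulN1r subr_le0 (bigD1 (Q1, Q2)) //= -[leLHS]addr0 lerD//; last exact: sumr_ge0.
  have [h1 h2 h3 _ _] := and5P VQ.
  rewrite /bad no_cross_edge//=; first exact: disjoint_cover tP h1 h2 h3.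
  move=> u v uQ vQ; apply: contraNN nQ => uv.
  by apply/existsP; exists u; rewrite uQ; apply/existsP; exists v; rewrite vQ.
rewrite meanD meanZ mean_cst mean_sum mulN1r lerD2l lerN2.
apply: (@le_trans _ _ (\sum_(Q | V Q) (1 - p) ^+ (m * m))).
  apply: ler_sum => Q /and5P[h1 h2 h3 h4 h5]; rewrite mean_disjoint count_enum.
  have dC := disjoint_cover tP h1 h2 h3.
  have -> : [set e in complete_graph n | e \in cross (cover Q.1) (cover Q.2)] =
      cross (cover Q.1) (cover Q.2).
    apply/setP => e; rewrite inE; apply/andP/idP => [[]//|ec]; split=> //.
    exact: (subsetP (cross_complete dC)).
  rewrite card_cross// ler_wiXn2l ?subr_ge0//; first by rewrite gerBl.
  exact: leq_mul.
rewrite sumr_const -[leLHS]mulr_natl ler_wpM2r//; first by rewrite exprn_ge0// subr_ge0.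
(* Keeping only that both subfamilies lie in [P] leaves [2 ^ #|P|] choices for each. *)
rewrite ler_nat (_ : 4 ^ #|P| = #|setX (powerset P) (powerset P)|)%N; last first.
  by rewrite cardsX card_powerset -expnMn.
apply: subset_leq_card; apply/subsetP => -[Q1 Q2] /and5P[h1 h2 _ _ _].
by rewrite in_setX !powersetE h1.
Qed.

(* An edge between [S i] and [S j] is labelled by the edge [[set i; j]] of the contraction. *)
Definition label n t (S : 'I_t -> {set 'I_n}) (e : {set 'I_n}) : {set 'I_t} :=
  [set i | S i :&: e != set0].

Lemma label2 n t (S : 'I_t -> {set 'I_n}) i j u v :
  (forall i j, i != j -> [disjoint S i & S j]) -> u \in S i -> v \in S j ->
  label S [set u; v] = [set i; j].
Proof.
move=> dS uS vS; apply/setP => k; rewrite !inE; apply/set0Pn/orP.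
  move=> [x]; rewrite !inE => /andP[xS] /orP[/eqP xu|/eqP xv]; [left|right];
    apply: contraTT xS => /dS; rewrite disjoint_sym.
    by rewrite xu => /disjointFr ->.
  by rewrite xv => /disjointFr ->.
by move=> [/eqP ->|/eqP ->]; [exists u|exists v]; rewrite !inE eqxx ?orbT andbT.
Qed.

Lemma count_label n t (S : 'I_t -> {set 'I_n}) i j :
  (forall i j, i != j -> [disjoint S i & S j]) -> i != j ->
  (#|S i| * #|S j| <= count (fun e => label S e == [set i; j]) (enum (complete_graph n)))%N.
Proof.
move=> dS ij; rewrite -card_cross ?dS// count_enum; apply: subset_leq_card.
apply/subsetP => e ec; rewrite inE (subsetP (cross_complete (dS _ _ ij)))//=.
move: ec => /imsetP[[u v]]; rewrite in_setX /= => /andP[uA vB] ->.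
by rewrite (label2 dS uA vB).
Qed.

(** The chunks are the branch sets. Intersecting with [complete_graph t] discards the labels of
    edges that do not join two different chunks. *)
Lemma contraction_minor n t (E G : sgraph n) (S : 'I_t -> {set 'I_n}) :
  (forall i, S i != set0) -> (forall i j, i != j -> [disjoint S i & S j]) ->
  (forall i, connected_in E (S i)) -> G \subset complete_graph n ->
  minor ([set label S e | e in G] :&: complete_graph t) (E :|: G).
Proof.
move=> S0 dS cS GK; exists S; split=> //.
- by move=> i j ij; rewrite setI_eq0 dS.
- by move=> i; apply: connected_inS (cS i); apply: subsetUl.
move=> i j /andP[ij]; rewrite inE => /andP[/imsetP[e eG le] _].
have : i \in label S e by rewrite -le set21.
have : j \in label S e by rewrite -le set22.
rewrite !inE => /set0Pn[v]; rewrite inE => /andP[vS ve] /set0Pn[u].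
rewrite inE => /andP[uS ue]; exists u, v; split=> //.
have uv : u != v by apply: contraTneq uS => ->; rewrite (disjointFl (dS _ _ ij) vS).
rewrite /adj uv inE; apply/orP; right; rewrite (_ : [set u; v] = e)//.
apply/eqP; rewrite eqEcard cards2 uv subUset !sub1set ue ve /=.
by have := subsetP GK e eG; rewrite inE => /eqP ->.
Qed.

(** * Two-round exposure *)

From mathcomp Require Import boolp reals.

Lemma is_graphE n (E : sgraph n) : is_graph E = (E \subset complete_graph n).
Proof.
apply/forallP/subsetP => [h e eE|h e]; first by rewrite inE; have := h e; rewrite eE.
by apply/implyP => /h; rewrite inE.
Qed.

Lemma PrGnpE (R : realType) n (p : R) (A : sgraph n -> Prop) :
  PrGnp p A = mean (enum (complete_graph n)) (fun=> p) (fun E => `[< A E >]%:R).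
Proof.
rewrite meanE ?enum_uniq// /PrGnp.
have sE (E : sgraph n) : (E \subset enum (complete_graph n)) = is_graph E.
  by rewrite is_graphE; apply: eq_subset_r => e; rewrite mem_enum.
have -> : size (enum (complete_graph n)) = 'C(n, 2).
  by rewrite -cardE card_draws card_ord.
rewrite (eq_bigl _ _ sE) big_mkcondr; apply: eq_bigr => E _.
by case: asboolP => _; rewrite ?mulr1 ?mulr0.
Qed.

Lemma PrGnp_le1 (R : realType) n (p : R) (A : sgraph n -> Prop) : 0 <= p <= 1 -> PrGnp p A <= 1.
Proof.
move=> p01; rewrite PrGnpE -[leRHS](mean_cst (enum (complete_graph n)) (fun=> p)).
by apply: mean_le => // E _; rewrite lern1 leq_b1.
Qed.

Lemma PrGnp_ge0 (R : realType) n (p : R) (A : sgraph n -> Prop) : 0 <= p <= 1 -> 0 <= PrGnp p A.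
Proof.
move=> p01; rewrite PrGnpE -[leLHS](mean_cst (enum (complete_graph n)) (fun=> p)).
exact: mean_le.
Qed.

Lemma le_PrGnp (R : realType) n (p : R) (A B : sgraph n -> Prop) :
  0 <= p <= 1 -> (forall E, A E -> B E) -> PrGnp p A <= PrGnp p B.
Proof.
move=> p01 AB; rewrite !PrGnpE; apply: mean_le => // E _.
by rewrite ler_nat; case: asboolP => // /AB BE; case: asboolP.
Qed.

Lemma minor_sub n (E E' : sgraph n) : E \subset E' -> minor E E'.
Proof.
move=> EE'; exists (fun i => [set i]); split.
- by move=> i; apply/set0Pn; exists i; rewrite inE.
- move=> i j ij; rewrite setI_eq0 disjoints1 inE //.
- by move=> i; apply: connected_in1.
- by move=> i j ij; exists i, j; rewrite !inE; split=> //; apply: adjS ij.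
Qed.

(* Conditionally on the first round, the contraction of the chunks in the second round
   dominates [G(t, q)]. *)
Lemma second_round (R : realType) (f : forall n, sgraph n -> R) n t (E : sgraph n)
    (S : 'I_t -> {set 'I_n}) (b : nat) (p q a : R) :
  minor_monotone f -> is_graph E -> (0 < b)%N ->
  (forall i, connected_in E (S i)) -> (forall i, b <= #|S i|)%N ->
  (forall i j, i != j -> [disjoint S i & S j]) ->
  0 <= p <= 1 -> 0 <= q <= 1 -> (1 - p) ^+ (b * b) <= 1 - q ->
  PrGnp q (fun T => a <= f t T) <= PrGnp p (fun G => a <= f n (E :|: G)).
Proof.
move=> mf gE b0 cS bS dS /andP[p0 p1] q01 pq; have /andP[q0 q1] := q01.
(* The intersection makes [F] ignore labels that are not pairs, as [mean_imset] requires. *)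
pose F (T : sgraph t) : R := (a <= f t (T :&: complete_graph t))%R%:R.
have gI (T : sgraph t) : is_graph (T :&: complete_graph t) by rewrite is_graphE subsetIr.
apply: (@le_trans _ _ (mean (enum (complete_graph t)) (fun=> q) F)).
  rewrite PrGnpE; apply: mean_le => // T TK; rewrite /F asboolb (setIidPl _)//.
  by apply/subsetP => e /(subsetP TK); rewrite mem_enum.
apply: (@le_trans _ _ (mean (enum (complete_graph n)) (fun=> p) (fun G => F [set label S e | e in G]))).
  rewrite (mean_imset (label S) (L := enum (complete_graph t))) ?enum_uniq//; last first.
    move=> j T; rewrite mem_enum => jK; rewrite /F setIUl (_ : [set j] :&: _ = set0) ?set0U//.
    by apply/setP => e; rewrite !inE; case: eqP => // ->; move: jK; rewrite inE => /negPf.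
  have np : 0 <= 1 - p <= 1 by rewrite subr_ge0 p1 gerBl.
  have /andP[np0 np1] := np.
  apply: mean_mono => //.
  - by move=> j _; rewrite subr_ge0 exprn_ile1//= gerBl exprn_ge0.
  (* A pair of chunks has at least [b * b] potential edges, so its label is absent with probability
     at most [(1 - p) ^+ (b * b)], hence present with probability at least [q]. *)
  - move=> J; rewrite mem_enum inE => /cards2P[i [j [ij ->]]].
    rewrite lerBrDr -lerBrDl; apply: le_trans pq.
    apply: ler_wiXn2l => //; apply: leq_trans (count_label dS ij).
    exact: leq_mul.
  - move=> T T' TT'; rewrite /F ler_nat; case: (boolP (a <= f t (T :&: _))) => // aT.
    rewrite (le_trans aT)//; apply: mf => //; apply: minor_sub; exact: setSI.
rewrite PrGnpE; apply: mean_le => [e _|G GK]; first by rewrite p0.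
have {}GK : G \subset complete_graph n.
  by apply/subsetP => e /(subsetP GK); rewrite mem_enum.
rewrite asboolb /F ler_nat; case: (boolP (a <= _)) => // aT.
rewrite (le_trans aT)//; apply: mf => //.
  by rewrite is_graphE subUset GK -is_graphE gE.
apply: contraction_minor => // i.
by rewrite -card_gt0; apply: leq_trans (bS i).
Qed.

(** The two rounds combined, for pieces of at most [b = d * k] vertices. In the vertex budget, [k]
    pays for the vertices outside all pieces and the other terms are those of [exists_chunks]. [N]
    is the number of pieces. *)
Lemma sprinkling (R : realType) (f : forall n, sgraph n -> R) n t (H : sgraph n)
    (d k m : nat) (p q a : R) :
  minor_monotone f -> is_graph H -> connected_graph H -> (maxdeg H <= d)%N ->
  (0 < d)%N -> (0 < k)%N -> (0 < m)%N ->
  (k + 2 * m + 2 * (d * k) + 3 * (d * k) * t <= n)%N ->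
  0 <= p <= 1 -> 0 <= q <= 1 ->
  (1 - p / 2) ^+ (2 * (d * k) * (2 * (d * k))) <= 1 - q ->
  exists2 N, (N * k <= n)%N &
  (1 - (4 ^ N)%:R * (1 - p / 2) ^+ (m * m)) * PrGnp q (fun T => a <= f t T) <=
  PrGnp p (fun G => a <= f n (gunion H G)).
Proof.
move=> mf gH cH dH d0 k0 m0 hn /andP[p0 p1] q01 pq.
have dH' v : (#|[set u | adj H v u]%SET| <= d)%N.
  by apply: leq_trans dH; rewrite /maxdeg; apply: leq_bigmax.
have cH' : connected_in H [set: 'I_n].
  move=> x y _ _; apply: connect_sub (cH x y) => {}x {}y xy; apply: connect1.
  by rewrite /= !inE.
have [P [tP _ cP hP]] := piece_packing d0 k0 dH' cH'.
rewrite cardsT card_ord in cP.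
exists #|P|.
  apply: (@leq_trans #|cover P|); last by rewrite -[leqRHS]card_ord max_card.
  rewrite -(eqP tP) -sum_nat_const; apply: leq_sum => A /hP[] //.
(* The first-round density solves [(1 - p1') * (1 - p / 2) = 1 - p]. It is at least [p / 2] because
   [1 - p <= (1 - p / 2) ^+ 2]. *)
pose p1' : R := 1 - (1 - p) / (1 - p / 2).
have h2 : 0 < 1 - p / 2 by lra.
have pp : 1 - (1 - p1') * (1 - p / 2) = p.
  by rewrite /p1'; field; apply: lt0r_neq0; lra.
have p1'E : 1 - p1' = (1 - p) / (1 - p / 2) by rewrite /p1'; ring.
have p1'le : 1 - p1' <= 1 - p / 2.
  by rewrite p1'E ler_pdivrMr//; have := sqr_ge0 p; nra.
have p1'ge : 0 <= 1 - p1' by rewrite p1'E divr_ge0//; lra.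
have p1'01 : 0 <= p1' <= 1 by apply/andP; split; lra.
have p201 : 0 <= p / 2 <= 1 by apply/andP; split; lra.
set c := PrGnp q _.
have c0 : 0 <= c by apply: PrGnp_ge0.
apply: (@le_trans _ _ (c * mean (enum (complete_graph n)) (fun=> p1') (fun G => (expands G P m)%:R))).
  rewrite mulrC ler_wpM2l//; apply: le_trans (mean_expands _ p1'01 tP).
  rewrite lerD2l lerN2 ler_wpM2l//; apply: lerXn2r => //; rewrite nnegrE//; lra.
rewrite PrGnpE -{1}pp mean_union -meanZ; apply: mean_le => // G GK.
have {}GK : G \subset complete_graph n.
  by apply/subsetP => e /(subsetP GK); rewrite mem_enum.
(* With the first round [G] fixed, a non-expanding [G] contributes zero on the left. *)
case: (boolP (expands G P m)) => eG; last first.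
  rewrite mulr0 -[leLHS](mean_cst (enum (complete_graph n)) (fun=> p / 2)).
  by apply: mean_le.
rewrite mulr1.
have eHG : expands (H :|: G) P m.
  apply/expandsP => Q1 Q2 h1 h2' h3 h4 h5.
  have /expandsP/(_ _ _ h1 h2' h3 h4 h5) [u [v [uQ vQ uv]]] := eG.
  by exists u, v; split=> //; apply: adjS uv; apply: subsetUr.
have hP' A : A \in P -> connected_in (H :|: G) A /\ (#|A| <= d * k)%N.
  by move=> /hP[cA _ ?]; split=> //; apply: connected_inS cA; apply: subsetUl.
have [|S [_ cS bS dS]] := exists_chunks (t := t) tP hP' eHG m0 (subxx P).
  by move: hn cP; clear; lia.
have gHG : is_graph (H :|: G) by rewrite is_graphE subUset GK -is_graphE gH.
have b0 : (0 < 2 * (d * k))%N by rewrite !muln_gt0 d0 k0.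
apply: le_trans (second_round a mf gHG b0 cS bS dS p201 q01 pq) _.
rewrite PrGnpE le_eqVlt; apply/orP; left; apply/eqP; apply: eq_mean => G'.
by rewrite /gunion setUA.
Qed.

(** * Asymptotics *)

From mathcomp Require Import all_classical all_reals all_analysis.
Import numFieldNormedType.Exports.
Local Open Scope classical_set_scope.
Local Open Scope ring_scope.

(** The bound is later applied with [t] and [q] both depending on [n], so it must be uniform in [q].
    Violating densities for different [t] can be collected into one sequence, to which the
    hypothesis applies. *)
Lemma bounded_below_uniform (R : realType) (f : forall n, sgraph n -> R) tf (c r e : R) :
  bounded_below f tf c r -> 0 < e ->
  exists t0 : nat, forall t q, (t0 <= t)%N -> c / t%:R <= q <= 1 ->
    1 - e <= PrGnp q (fun T => r * tf t q <= f t T).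
Proof.
move=> bf e0.
(* [q t] is a density violating the claim for [t], whenever there is one. *)
pose bad t q := c / t%:R <= q <= 1 /\ ~ (1 - e <= PrGnp q (fun T => r * tf t q <= f t T)).
pose q t : R := if pselect (exists q, bad t q) is left h then projT1 (cid h) else 1.
have badq t q' : bad t q' -> bad t (q t).
  move=> h; rewrite /q; case: pselect => [h'|[]]; last by exists q'.
  exact: (projT2 (cid h')).
have hq : \forall t \near \oo, c / t%:R <= q t <= 1.
  (* The default density 1 is admissible as soon as [t >= c]. *)
  near=> t; rewrite /q; case: pselect => [h|_]; first by case: (projT2 (cid h)).
  rewrite lexx andbT ler_pdivrMr ?mul1r; first by near: t; exact: nbhs_infty_ger.
  by rewrite ltr0n; near: t; exact: nbhs_infty_gt.
have /cvgrPdist_le/(_ e e0)[t0 _ ht0] := bf q hq.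
exists t0 => t q' tt0 hq'; apply: contrapT => nh.
have [_ []] := badq t q' (conj hq' nh).
by have := ht0 t tt0; rewrite ler_distlC => /andP[].
Unshelve. all: by end_near. Qed.

Lemma expr_le_expR (R : realType) (x : R) n : 0 <= 1 - x -> (1 - x) ^+ n <= expR (- (x * n%:R)).
Proof.
move=> x1; rewrite -mulNr mulrC expRM_natl; apply: lerXn2r; rewrite ?nnegrE ?expR_ge0//.
exact: expR_ge1Dx.
Qed.

Lemma four_pow_le (R : realType) N : (4 ^ N)%:R <= expR (2 * N%:R) :> R.
Proof.
rewrite mulrC expRM_natl natrX; apply: lerXn2r; rewrite ?nnegrE ?expR_ge0//.
have -> : 2 = 1 + 1 :> R by [].
have h : 2 <= expR 1 :> R by have := expR_ge1Dx (1 : R); lra.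
rewrite expRD; nra.
Qed.

(** Put [X = n^2 p]. Then [N <= X / 200], so [4 ^ N <= exp(X / 100)], while [m >= n / 5] makes the
    second factor at most [exp(- X / 50)]. The product is at most [exp(- X / 100) <= 100 / X]. *)
Lemma union_bound_small (R : realType) (n N k m : nat) (p A : R) :
  200 <= A -> 0 < p <= 1 -> (0 < n)%N -> (N * k <= n)%N -> A / (n%:R * p) <= k%:R ->
  (n <= 5 * m)%N ->
  (4 ^ N)%:R * (1 - p / 2) ^+ (m * m) <= 100 / (n%:R ^+ 2 * p).
Proof.
move=> hA /andP[p0 p1] n0 Nk hk nm.
have n0' : 0 < n%:R :> R by rewrite ltr0n.
have np0 : 0 < n%:R * p by rewrite mulr_gt0.
set X := n%:R ^+ 2 * p; have X0 : 0 < X by rewrite mulr_gt0// exprn_gt0.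
have NX : 200 * N%:R <= X.
  have NkR : N%:R * k%:R <= n%:R :> R by rewrite -natrM ler_nat.
  have h : N%:R * (A / (n%:R * p)) <= n%:R by apply: le_trans NkR; rewrite ler_wpM2l.
  have := ler_wpM2r (ltW np0) h; rewrite mulrA divfK ?lt0r_neq0// => h'.
  have -> : X = n%:R * (n%:R * p) by rewrite /X; ring.
  apply: le_trans h'; by rewrite [leLHS]mulrC ler_wpM2l.
have mX : X <= 25 * (p * (m * m)%:R).
  have nmR : n%:R <= 5 * m%:R :> R by rewrite -natrM ler_nat.
  have : n%:R ^+ 2 <= (5 * m%:R) ^+ 2 :> R by rewrite lerXn2r// nnegrE.
  move=> /(ler_wpM2r (ltW p0)); rewrite natrM /X; lra.
apply: (@le_trans _ _ (expR (2 * N%:R) * expR (- (p / 2 * (m * m)%:R)))).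
  apply: ler_pM => //; first by rewrite exprn_ge0//; lra.
    exact: four_pow_le.
  by apply: expr_le_expR; lra.
rewrite -expRD; apply: (@le_trans _ _ (expR (- (X / 100)))).
  by rewrite ler_expR; lra.
rewrite expRN -[leRHS]invrK invf_div lef_pV2 ?posrE ?divr_gt0 ?expR_gt0//.
have := expR_ge1Dx (X / 100); lra.
Qed.

(** With [K = A / (np) >= 100], rounding costs at most one percent: [k <= 1.01 K]. The hypotheses on
    [d] and [t] say [d K <= n / 100] and [t d K <= n / 200], so the pieces and chunks take a small
    fraction of [n]. *)
Lemma packing_budget (R : realType) (n d k m t : nat) (p A : R) :
  200 <= A -> 4 <= n%:R :> R -> 1 <= d%:R :> R -> 0 < p -> n%:R * p <= 2 ->
  d%:R <= n%:R ^+ 2 * p / (100 * A) ->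
  A / (n%:R * p) <= k%:R -> k%:R <= A / (n%:R * p) + 1 ->
  5 * m%:R <= n%:R + 5 :> R -> t%:R <= n%:R ^+ 2 * p / (200 * A * d%:R) ->
  (k + 2 * m + 2 * (d * k) + 3 * (d * k) * t <= n)%N.
Proof.
move=> hA n4 d1 p0 np2 hd kK kK1 hm ht.
rewrite -(ler_nat R) !natrD !natrM.
move: (n%:R) (d%:R) (k%:R) (m%:R) (t%:R : R) (ler0n R t) n4 d1 np2 hd kK kK1 hm ht.
move=> {n d k m t} n d k m t t0 n4 d1 np2 hd kK kK1 hm ht.
have n0 : 0 < n by apply: lt_le_trans n4.
have A0 : 0 < A by apply: lt_le_trans hA.
have d0 : 0 < d by apply: lt_le_trans d1.
have np0 : 0 < n * p by rewrite mulr_gt0.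
have XE : n ^+ 2 * p = n * (n * p) by ring.
move: XE hd ht kK kK1; set X := n ^+ 2 * p; set K := A / (n * p) => XE hd ht kK kK1.
have KE : K * (n * p) = A by rewrite /K divfK// lt0r_neq0.
have K100 : 100 <= K.
  rewrite -(ler_pM2r np0) KE; apply: le_trans hA.
  by rewrite (_ : 200 = 100 * 2) ?ler_wpM2l// -natrM.
have DK : 100 * (d * K) <= n.
  move: hd; rewrite ler_pdivlMr ?mulr_gt0// XE => hd.
  rewrite -(ler_pM2r np0); suff -> : 100 * (d * K) * (n * p) = d * (100 * A) by [].
  by rewrite -KE; ring.
have tX : 200 * (t * (d * K)) <= n.
  move: ht; rewrite ler_pdivlMr ?mulr_gt0// XE => ht.
  rewrite -(ler_pM2r np0); apply: le_trans ht.
  by rewrite -KE le_eqVlt; apply/orP; left; apply/eqP; ring.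
have kK' : 100 * k <= 101 * K by clear - K100 kK1; lra.
have dk : 100 * (d * k) <= 101 * (d * K).
  have -> : 100 * (d * k) = d * (100 * k) by ring.
  have -> : 101 * (d * K) = d * (101 * K) by ring.
  by rewrite ler_wpM2l// ltW.
have tdk : 100 * (t * (d * k)) <= 101 * (t * (d * K)).
  have -> : 100 * (t * (d * k)) = t * (100 * (d * k)) by ring.
  have -> : 101 * (t * (d * K)) = t * (101 * (d * K)) by ring.
  by rewrite ler_wpM2l.
have kd : k <= d * k by rewrite ler_peMl// (le_trans _ kK)// ltW// divr_gt0.
have -> : 3 * (d * k) * t = 3 * (t * (d * k)) by ring.
(* The total is below [0.45 n + 2], the 2 coming from rounding [m]; [n >= 4] absorbs it. *)
move: (d * k) (t * (d * k)) (d * K) (t * (d * K)) kd tdk dk tX DK hm n4; clear=> *; lra.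
Qed.

(** Two chunks of [2 d k] vertices span [4 (d k)^2] pairs. The factor 4 makes up for the halved
    density, with a factor 2 to spare. *)
Lemma chunk_nonadjacency (R : realType) (n d k : nat) (p A : R) :
  0 < n%:R :> R -> 0 < p <= 1 -> 0 <= A -> A / (n%:R * p) <= k%:R ->
  (1 - p / 2) ^+ (2 * (d * k) * (2 * (d * k))) <=
  expR (- ((A * d%:R) ^+ 2 / (n%:R ^+ 2 * p))).
Proof.
move=> n0 /andP[p0 p1] A0 kK; apply: le_trans (expr_le_expR _ _) _; first lra.
rewrite ler_expR lerN2 !natrM.
move: (n%:R) (d%:R) (k%:R) (ler0n R d) n0 kK => {n d k} n d k d0 n0 kK.
have -> : (A * d) ^+ 2 / (n ^+ 2 * p) = p * (d * (A / (n * p))) ^+ 2.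
  by field; rewrite !lt0r_neq0.
have -> : p / 2 * (2 * (d * k) * (2 * (d * k))) = 2 * (p * (d * k) ^+ 2) by field.
have K0 : 0 <= A / (n * p) by rewrite divr_ge0// mulr_ge0// ltW.
have h : p * (d * (A / (n * p))) ^+ 2 <= p * (d * k) ^+ 2.
  apply: ler_wpM2l; first exact: ltW.
  have k0 := le_trans K0 kK.
  by apply: lerXn2r; rewrite ?nnegrE; [exact: mulr_ge0|exact: mulr_ge0|exact: ler_wpM2l].
have h2 : 0 <= p * (d * k) ^+ 2 by apply: mulr_ge0; [exact: ltW|exact: sqr_ge0].
by apply: le_trans h _; apply: ler_peMl => //; rewrite ler1n.
Qed.

Lemma one_sub_expRN_itv (R : realType) (x : R) : 0 <= x -> 0 <= 1 - expR (- x) <= 1.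
Proof. by move=> x0; rewrite subr_ge0 -{1}expR0 ler_expR oppr_le0 x0 gerBl expR_ge0. Qed.

Lemma sprinkling_asymptotic (R : realType) (f : forall n, sgraph n -> R) n (H : sgraph n)
    (p A a : R) :
  minor_monotone f -> is_graph H -> connected_graph H -> (1 <= maxdeg H)%N ->
  200 <= A -> (4 <= n)%N -> 0 < p <= 2 / n%:R ->
  let X := n%:R ^+ 2 * p in
  let D : R := (maxdeg H)%:R in
  let t := Num.truncn (X / (200 * A * D)) in
  let q := 1 - expR (- ((A * D) ^+ 2 / X)) in
  D <= X / (100 * A) ->
  (1 - 100 / X) * PrGnp q (fun T => a <= f t T) <= PrGnp p (fun G => a <= f n (gunion H G)).
Proof.
move=> mf gH cH d1 hA n4 /andP[p0 p2] X D t q hD.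
have n1 : (0 < n)%N by apply: leq_trans n4.
have n0 : 0 < n%:R :> R by rewrite ltr0n.
have n4R : 4 <= n%:R :> R by rewrite (ler_nat _ 4).
have np2 : n%:R * p <= 2 by rewrite mulrC -ler_pdivlMr.
have p1 : p <= 1.
  by apply: le_trans p2 _; rewrite ler_pdivrMr// mul1r (ler_nat _ 2); apply: leq_trans n4.
have A0 : 0 <= A by apply: le_trans hA.
have X0 : 0 <= X by rewrite mulr_ge0 ?exprn_ge0// ltW.
have q01 : 0 <= q <= 1 by apply: one_sub_expRN_itv; rewrite divr_ge0// sqr_ge0.
pose K := A / (n%:R * p).
have K0 : 0 <= K by rewrite divr_ge0// mulr_ge0// ltW.
(* Rounding up gives [K <= k <= K + 1]; likewise [m] is [n %/ 5 + 1], so that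
   [n <= 5 m <= n + 5]. *)
pose k := (Num.truncn K).+1.
have kK : K <= k%:R by apply: ltW; apply: truncnS_gt.
have kK1 : k%:R <= K + 1 by rewrite -natr1 lerD2r truncn_le.
have div5 j : (j <= 5 * (j %/ 5).+1 <= j + 5)%N by clear; lia.
have /andP[nm mn] := div5 n.
have mnR : 5 * (n %/ 5).+1%:R <= n%:R + 5 :> R by rewrite -natrM -natrD ler_nat.
have tX : t%:R <= X / (200 * A * D) by rewrite truncn_le// divr_ge0// !mulr_ge0.
have D1 : 1 <= D by rewrite (ler_nat _ 1).
have budget := packing_budget hA n4R D1 p0 np2 hD kK kK1 mnR tX.
have p01 : 0 <= p <= 1 by rewrite (ltW p0).
have p01' : 0 < p <= 1 by rewrite p0.
have nonadj : (1 - p / 2) ^+ (2 * (maxdeg H * k) * (2 * (maxdeg H * k))) <= 1 - q.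
  by rewrite subKr; apply: chunk_nonadjacency.
have [N Nk hN] := sprinkling a mf gH cH (leqnn _) d1 (ltn0Sn _) (ltn0Sn _) budget p01 q01 nonadj.
apply: le_trans hN; rewrite ler_wpM2r ?PrGnp_ge0// lerD2l lerN2.
exact: union_bound_small hA p01' n1 Nk kK nm.
Qed.

(** * The two ranges of the maximum degree *)

Lemma PrGnp_complete (R : realType) (f : forall n, sgraph n -> R) t (q : R) :
  0 <= q <= 1 -> 1 - t%:R ^+ 2 * (1 - q) <= PrGnp q (fun T => f t (complete_graph t) <= f t T).
Proof.
move=> q01; rewrite PrGnpE; have /andP[q0 q1] := q01.
pose F (T : sgraph t) : R := (f t (complete_graph t) <= f t (T :&: complete_graph t)%SET)%R%:R.
apply: (@le_trans _ _ (mean (enum (complete_graph t)) (fun=> q) F)); last first.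
  apply: mean_le => // T TK; rewrite /F asboolb (finset.setIidPl _)//.
  by apply/fintype.subsetP => e /(fintype.subsetP TK); rewrite mem_enum.
apply: le_trans (_ : _ <= 1 - (size (enum (complete_graph t)))%:R * (1 - q)) _; last first.
  apply: mean_ge_all => // T KT; rewrite /F (finset.setIidPr _) ?lexx//.
  by apply/fintype.subsetP => e eK; apply: KT; rewrite mem_enum.
rewrite lerD2l lerN2 ler_wpM2r ?subr_ge0// -natrX ler_nat -cardE card_draws card_ord.
rewrite bin2 -divn2; apply: leq_trans (leq_div _ _) _.
by rewrite -mulnn leq_mul2l leq_pred orbT.
Qed.

(** Here [D^2 > X log X] forces the exponent [(A D)^2 / X] to be at least [3 log X], so the expected
    number of missing edges among [t <= X] vertices is at most [X^2 * X^(-3)]. *)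
Lemma dense_regime (R : realType) (f : forall n, sgraph n -> R) (t : nat) (X A D : R) :
  200 <= A -> 1 <= D -> 1 <= X -> Num.sqrt (X * ln X) < D -> t%:R <= X ->
  1 - 1 / X <= PrGnp (1 - expR (- ((A * D) ^+ 2 / X)))
                 (fun T => f t (complete_graph t) <= f t T).
Proof.
move=> hA D1 X1 hD tX; set q := 1 - expR _.
have X0 : 0 < X by lra.
have D0 : 0 < D by lra.
have lX : 0 <= ln X by apply: ln_ge0.
have DX : X * ln X <= D ^+ 2.
  rewrite -[leLHS]sqr_sqrtr ?mulr_ge0 ?(ltW X0)//.
  by rewrite lerXn2r ?nnegrE ?sqrtr_ge0 ?(ltW D0)// ltW.
have M3 : 3 * ln X <= (A * D) ^+ 2 / X.
  rewrite ler_pdivlMr//; have -> : (A * D) ^+ 2 = A ^+ 2 * D ^+ 2 by ring.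
  have : 3 <= A ^+ 2 by apply: (@le_trans _ _ (200 * A)); [lra|rewrite expr2 ler_wpM2r//; lra].
  have D2 : 0 <= D ^+ 2 by apply: sqr_ge0.
  move=> /(ler_wpM2r D2); lra.
have q01 : 0 <= q <= 1.
  by apply: one_sub_expRN_itv; rewrite divr_ge0 ?sqr_ge0// ltW.
apply: le_trans (PrGnp_complete f t q01); rewrite lerD2l lerN2 subKr.
have e3 : expR (- ((A * D) ^+ 2 / X)) <= (X ^+ 3)^-1.
  apply: (@le_trans _ _ (expR (- (3 * ln X)))); first by rewrite ler_expR lerN2.
  by rewrite expRN mulrC expRM_natr lnK ?posrE.
apply: (@le_trans _ _ (X ^+ 2 * (X ^+ 3)^-1)).
  by apply: ler_pM; rewrite ?exprn_ge0 ?expR_ge0// lerXn2r ?nnegrE ?(ltW X0).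
by rewrite le_eqVlt; apply/orP; left; apply/eqP; field; rewrite lt0r_neq0.
Qed.

(** Shows that the order [t] of the minor tends to infinity. From [log X <= 2 sqrt X] one gets
    [D^4 <= 4 X^3]; comparing fourth powers then gives the claim. *)
Lemma sparse_regime (R : realType) (X L D Z : R) :
  0 < L -> 1 <= D -> 0 <= Z -> 4 * (L * Z) ^+ 4 <= X -> 1 <= X ->
  D <= Num.sqrt (X * ln X) -> Z <= X / (L * D).
Proof.
move=> L0 D1 Z0 hX X1 hD.
have X0 : 0 < X by lra.
have D0 : 0 < D by lra.
have lX : 0 <= ln X by apply: ln_ge0.
have sX0 : 0 <= Num.sqrt X by apply: sqrtr_ge0.
have sX : Num.sqrt X ^+ 2 = X by rewrite sqr_sqrtr// ltW.
have DX : D ^+ 2 <= X * ln X.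
  rewrite -[leRHS]sqr_sqrtr ?mulr_ge0 ?(ltW X0)//.
  by rewrite lerXn2r ?nnegrE ?sqrtr_ge0 ?(ltW D0).
(* Write [ln X] as twice the logarithm of [sqrt X]. *)
have lnX : ln X <= 2 * Num.sqrt X.
  have s0 : 0 < Num.sqrt X by rewrite sqrtr_gt0.
  rewrite -{1}sX lnXn// mulr2n.
  have := ln_sublinear s0; lra.
have D4 : D ^+ 4 <= 4 * X ^+ 3.
  have h : D ^+ 2 <= 2 * X * Num.sqrt X.
    by apply: le_trans DX _; rewrite (mulrC 2 X) -mulrA; apply: ler_wpM2l => //; lra.
  have : (D ^+ 2) ^+ 2 <= (2 * X * Num.sqrt X) ^+ 2.
    by rewrite lerXn2r ?nnegrE ?sqr_ge0// mulr_ge0//; lra.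
  have -> : (2 * X * Num.sqrt X) ^+ 2 = 4 * (X ^+ 2 * Num.sqrt X ^+ 2) by ring.
  by rewrite sX -exprSr -exprM.
rewrite ler_pdivlMr; last by rewrite mulr_gt0.
rewrite -(ler_pXn2r (n := 4)) ?nnegrE ?mulr_ge0 ?(ltW D0) ?(ltW X0) ?(ltW L0)//.
have -> : (Z * (L * D)) ^+ 4 = (L * Z) ^+ 4 * D ^+ 4 by ring.
have A0 : 0 <= (L * Z) ^+ 4 by rewrite exprn_ge0// mulr_ge0// ltW.
have := ler_wpM2l A0 D4.
have X3 : 0 <= X ^+ 3 by rewrite exprn_ge0// ltW.
have := ler_wpM2r X3 hX.
rewrite [X ^+ 4]exprS; lra.
Qed.

(** Checks that [q] lies in the range where the bound on [f] is assumed. Since [q >= M / (1 + M)]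
    and [t > Y - 1], it suffices that [c (1 + M) <= M (Y - 1)]; this follows by averaging
    [M Y = A D / 200 >= 4 c] and [M Y >= M (2 c + 3)]. *)
Lemma edge_density_lower_bound (R : realType) (X A D c : R) :
  0 < c -> 960 * c <= A -> 1 <= D -> 0 < X ->
  let Y := X / (200 * A * D) in
  2 * c + 3 <= Y ->
  c / (Num.truncn Y)%:R <= 1 - expR (- ((A * D) ^+ 2 / X)) <= 1.
Proof.
move=> c0 cA D1 X0 Y hY.
have A0 : 0 < A by lra.
have L0 : 0 < 200 * A * D by rewrite !mulr_gt0//; lra.
rewrite gerBl expR_ge0 andbT.
set M := (A * D) ^+ 2 / X; set t : R := (Num.truncn Y)%:R.
have tY : Y - 1 < t.
  by rewrite ltrBlDr /t natr1 truncnS_gt.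
have t0 : 0 < t by lra.
have Y0 : 0 < Y by lra.
have XY : X = 200 * A * D * Y by rewrite /Y mulrC divfK// lt0r_neq0.
have MY : 200 * (M * Y) = A * D.
  by rewrite /M XY; field; rewrite !lt0r_neq0//; lra.
have AD : 960 * c <= A * D by apply: (le_trans cA); rewrite ler_peMr// ltW.
have cMY : 4 * c <= M * Y by lra.
have M0 : 0 < M by rewrite divr_gt0// exprn_gt0// !mulr_gt0//; lra.
have eM : expR (- M) <= (1 + M)^-1.
  rewrite expRN lef_pV2 ?posrE ?expR_gt0//; [exact: expR_ge1Dx|lra].
apply: (@le_trans _ _ (1 - (1 + M)^-1)); last by rewrite lerD2l lerN2.
have -> : 1 - (1 + M)^-1 = M / (1 + M) by field; apply: lt0r_neq0; lra.
rewrite ler_pdivrMr// mulrAC ler_pdivlMr; last by lra.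
have MtM : M * (Y - 1) <= M * t by rewrite ler_wpM2l// ltW.
have M1 : M * 3 <= M * Y by rewrite ler_wpM2l ?(ltW M0)//; lra.
have M2 : M * (2 * c + 3) <= M * Y by rewrite ler_wpM2l ?(ltW M0).
have cM : 0 < c * M by rewrite mulr_gt0.
clear - M0 MtM M2 M1 cMY cM; clearbody M t Y; lra.
Qed.

(** The parameter [A] stands for [96 C]: then [9600 C = 100 A], [19200 C = 200 A], and [C >= 10 c]
    reads [A >= 960 c]. *)
Lemma whp_union (R : realType)
  (f : forall n, sgraph n -> R) (tf : nat -> R -> R) (c r A B L : R)
  (p : nat -> R) (H : forall n, sgraph n) :
  minor_monotone f ->
  1 < c -> bounded_below f tf c r ->
  960 * c <= A -> B = 100 * A -> L = 200 * A ->
  (\forall n \near \oo, 0 < p n <= 2 / n%:R) ->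
  (fun n => n%:R ^+ 2 * p n) @ \oo --> +oo ->
  (\forall n \near \oo,
     [/\ is_graph (H n), connected_graph (H n),
         (1 <= maxdeg (H n))%N &
         (maxdeg (H n))%:R <= n%:R ^+ 2 * p n / B]) ->
  whp (fun n G =>
    let D : R := (maxdeg (H n))%:R in
    let LD : R := L * D in
    let M : R := (A * D) ^+ 2 / (n%:R ^+ 2 * p n) in
    let t : nat := Num.truncn (n%:R ^+ 2 * p n / LD) in
    let Rg := gunion (H n) G in
    if D <= Num.sqrt (n%:R ^+ 2 * p n * ln (n%:R ^+ 2 * p n))
    then f n Rg >= r * tf t (1 - expR (- M))
    else f n Rg >= f t (complete_graph t)) p.
Proof.
move=> mf c1 bf hA -> -> hp /cvgryPge hX hH.
have A200 : 200 <= A by clear - hA c1; lra.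
apply/cvgrPdist_le => e e0.
have e2 : 0 < e / 2 by apply: divr_gt0.
have [t0 ht0] := bounded_below_uniform bf e2.
(* A threshold for [X / (200 A D)] that serves both the uniform bound, through [t0], and the density
   estimate, through [2 c + 3]. *)
pose Z : R := t0%:R + 2 * c + 3.
have Z0 : 0 <= Z by rewrite /Z; have : 0 <= t0%:R :> R by []; clear - c1; lra.
near=> n.
have n4 : (4 <= n)%N by near: n; exact: nbhs_infty_ge.
have pn : 0 < p n <= 2 / n%:R by near: n.
have [gH cH d1 hD] : [/\ is_graph (H n), connected_graph (H n),
         (1 <= maxdeg (H n))%N &
         (maxdeg (H n))%:R <= n%:R ^+ 2 * p n / (100 * A)] by near: n.
have X1 : 1 <= n%:R ^+ 2 * p n by near: n; exact: hX.
have Xe : 200 / e <= n%:R ^+ 2 * p n by near: n; exact: hX.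
have XZ : 4 * (200 * A * Z) ^+ 4 <= n%:R ^+ 2 * p n by near: n; exact: hX.
have p01 : 0 <= p n <= 1.
  have /andP[p0 p2] := pn; rewrite (ltW p0) (le_trans p2)//.
  by rewrite ler_pdivrMr ?ltr0n ?mul1r ?(ler_nat _ 2); apply: leq_trans n4.
rewrite ler_distlC; apply/andP; split; last by apply: le_trans (PrGnp_le1 _ p01) _; rewrite lerDl ltW.
set X := n%:R ^+ 2 * p n in X1 Xe XZ hD *.
set D : R := (maxdeg (H n))%:R in hD *.
have D1 : 1 <= D by rewrite (ler_nat _ 1).
set t := Num.truncn (X / (200 * A * D)).
set q := 1 - expR (- ((A * D) ^+ 2 / X)).
have q01 : 0 <= q <= 1.
  by apply: one_sub_expRN_itv; rewrite divr_ge0 ?sqr_ge0// (le_trans _ X1).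
have A0 : 0 < 200 * A by apply: mulr_gt0; [exact: ltr0Sn|exact: lt_le_trans A200].
have X0 : 0 < X by apply: lt_le_trans X1.
(* The error splits evenly between the first round, which costs [100 / X], and the bound on [f] for
   [G(t, q)]. *)
have main a : 1 - e / 2 <= PrGnp q (fun T => a <= f t T) ->
    1 - e <= PrGnp (p n) (fun G => a <= f n (gunion (H n) G)).
  move=> ha; apply: le_trans (sprinkling_asymptotic a mf gH cH d1 A200 n4 pn hD).
  rewrite -/X -/D -/t -/q.
  have hX' : 100 / X <= e / 2.
    by move: Xe; rewrite !ler_pdivrMr//; clear; lra.
  have X00 : 0 <= 100 / X by rewrite divr_ge0// ltW.
  have := PrGnp_le1 (fun T => a <= f t T) q01.
  move: (PrGnp _ _) (100 / X) ha hX' X00 => P x; clear; nra.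
have [DX|DX] := leP D (Num.sqrt (X * ln X)).
  apply: le_trans (main (r * tf t q) _) _; last first.
    by apply: le_PrGnp => // G; cbv zeta; rewrite -/X -/D DX.
  have ZX := sparse_regime A0 D1 Z0 XZ X1 DX.
  have c0 : 0 < c by apply: lt_trans c1.
  apply: ht0.
    rewrite /t truncn_ge_nat; first by apply: le_trans ZX; rewrite /Z; clear - c1; lra.
    by apply: le_trans ZX.
  apply: edge_density_lower_bound => //; apply: le_trans ZX.
  by rewrite /Z -addrA ler_wpDl.
apply: le_trans (main (f t (complete_graph t)) _) _; last first.
  by apply: le_PrGnp => // G; cbv zeta; rewrite -/X -/D [D <= _]leNgt DX.
(* The denominator [200 A D] is at least 1. *)
have tX : t%:R <= X.
  have L1 : 1 <= 200 * A * D.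
    by rewrite mulr_ege1// mulr_ege1 ?(ler_nat _ 1)// (le_trans _ A200)// (ler_nat _ 1).
  apply: (@le_trans _ _ (X / (200 * A * D))).
    by rewrite truncn_le// divr_ge0// ?(ltW X0)// (le_trans _ L1).
  by rewrite ler_pdivrMr ?(lt_le_trans _ L1)// ler_peMr// ltW.
apply: le_trans (dense_regime f A200 D1 X1 DX tX).
rewrite lerD2l lerN2 ler_pdivrMr//.
move: Xe X0; rewrite ler_pdivrMr//; clear - e0; lra.
Unshelve. all: by end_near. Qed.

(** The order of the minor is an integer, so [n^2 p / L] is rounded down. *)
Theorem mainTheorem1 (R : realType)
  (f : forall n, sgraph n -> R) (tf : nat -> R -> R) (c r C : R)
  (p : nat -> R) (H : forall n, sgraph n) :
  minor_monotone f ->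
  (forall n x, 0 <= x <= 1 -> 0 <= tf n x) ->
  1 < c -> 0 <= r ->
  bounded_below f tf c r ->
  10 * c <= C ->
  (\forall n \near \oo, 0 < p n <= 2 / n%:R) ->
  (fun n => n%:R ^+ 2 * p n) @ \oo --> +oo ->
  (\forall n \near \oo,
     [/\ is_graph (H n), connected_graph (H n),
         (1 <= maxdeg (H n))%N &
         (maxdeg (H n))%:R <= n%:R ^+ 2 * p n / (9600 * C)]) ->
  whp (fun n G =>
    let D : R := (maxdeg (H n))%:R in
    let L : R := 19200 * C * D in
    let M : R := (96 * C * D) ^+ 2 / (n%:R ^+ 2 * p n) in
    let t : nat := Num.truncn (n%:R ^+ 2 * p n / L) in
    let Rg := gunion (H n) G in
    if D <= Num.sqrt (n%:R ^+ 2 * p n * ln (n%:R ^+ 2 * p n))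
    then f n Rg >= r * tf t (1 - expR (- M))
    else f n Rg >= f t (complete_graph t)) p.
Proof.
move=> mf _ c1 _ bf cC hp hX hH.
apply: (whp_union (A := 96 * C) (B := 9600 * C) mf c1 bf _ _ _ hp hX hH).
- by clear - cC; lra.
- by ring.
- by ring.
Qed.
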